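(* Let $X$ be a $Ps$-Tychonoff topological space. Then every subset $A$ of $X$, equipped with the subspace topology, is $Ps$-Tychonoff.
   Context: A topological space is pseudocompact if every real-valued continuous function on it is bounded; a subset is called pseudocompact if it is pseudocompact in the subspace topology. Tychonoff means completely regular and $T_1$. A space $X$ is $Ps$-Tychonoff if there exist a Tychonoff space $Y$ and a bijection $f:X\to Y$ such that $f|_K:K\to f(K)$ is a homeomorphism (subspace topologies) for every pseudocompact subset $K$ of $X$. *)

(* Defs.v *)
From mathcomp Require Import all_boot all_order all_algebra.
From mathcomp Require Import all_classical all_reals all_analysis.
Set Implicit Arguments.
Unset Strict Implicit.
Unset Printing Implicit Defensive.
Import Order.TTheory GRing.Theory Num.Theory.
Import numFieldNormedType.Exports.
Local Open Scope classical_set_scope.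
Local Open Scope ring_scope.

Definition pseudocompact (R : realType) (T : topologicalType) : Prop :=
  forall f : T -> R, continuous f -> bounded_fun f.

(* A subset [K : set T] is coerced to the subtype [set_type K], whose library
   topology is the initial topology of the inclusion, i.e. the subspace
   topology. *)
Definition pseudocompact_set (R : realType) (T : topologicalType)
    (K : set T) : Prop :=
  pseudocompact R (set_type K).

(* [completely_regular_space] is stated in the library with uniform separators;
   [tychonoffP] below gives the form with real-valued functions. *)
Definition tychonoff (T : topologicalType) : Prop :=
  completely_regular_space T /\ accessible_space T.

Lemma tychonoffP (R : realType) (T : topologicalType) :
  tychonoff T <->
  (forall (a : T) (B : set T), closed B -> ~ B a ->
     exists f : T -> R, [/\ continuous f, range f `<=` `[0, 1],
       f a = 0 & forall b, B b -> f b = 1]) /\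
  (forall a : T, closed [set a]).
Proof.
split=> [[cr ac]|[cr c1]]; split.
- move=> a B cB nBa; have /(@uniform_separatorP _ R) := cr a B cB nBa.
  move=> [f [cf f01 f0 f1]]; exists f; split=> //; first by apply: f0; exists a.
  by move=> b Bb; apply: f1; exists b.
- by apply/accessible_closed_set1.
- move=> a B cB nBa; apply/(@uniform_separatorP _ R).
  have [f [cf f01 f0 f1]] := cr a B cB nBa; exists f; split=> //.
    by move=> _ [_ -> <-].
  by move=> _ [b Bb <-]; exact: f1.
- move=> x y xy; exists (~` [set y]); split.
  + exact/closed_openC.
  + by rewrite inE => /= /eqP; exact/negP.
  + by rewrite inE setCK.
Qed.

Definition homeomorphism (T U : topologicalType) (f : T -> U) : Prop :=
  exists g : U -> T, [/\ cancel f g, cancel g f, continuous f & continuous g].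

(* [sigLR [fun f in K]] is the map [f|_K] as a function between the subtypes
   [set_type K] and [set_type (f @` K)]. *)
Definition ps_tychonoff (R : realType) (X : topologicalType) : Prop :=
  exists (Y : topologicalType) (f : X -> Y),
    [/\ tychonoff Y, bijective f &
        forall K : set X, pseudocompact_set R K ->
          homeomorphism (sigLR [fun f in K])].

(* Main.v *)
(* Transport the topology of Y to A along f|_A: this makes A a Tychonoff space A'
   with the same points, and the identity A -> A' is the required bijection.
   If K is a pseudocompact subset of A, its image in X is pseudocompact, hence f
   restricts to a homeomorphism there; this is exactly the statement that K has
   the same topology in A and in A'. *)
Require Import Defs.
From mathcomp Require Import all_boot all_order all_algebra.
From mathcomp Require Import all_classical all_reals all_analysis.

Set Implicit Arguments.
Unset Strict Implicit.
Unset Printing Implicit Defensive.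
Import numFieldNormedType.Exports.
Local Open Scope classical_set_scope.

Lemma pseudocompact_surj (R : realType) (T U : topologicalType) (g : T -> U) :
  continuous g -> (forall u, exists t, g t = u) ->
  pseudocompact R T -> pseudocompact R U.
Proof.
move=> cg sg pT h ch.
have cgh : continuous (h \o g).
  by move=> t; apply: continuous_comp; [exact: cg|exact: ch].
have [M [Mr HM]] := pT _ cgh; exists M; split=> // x Mx u _.
by have [t <-] := sg u; exact: HM.
Qed.

Lemma continuous_set_valP (T U : topologicalType) (B : set U) (g : T -> B) :
  continuous (set_val \o g) -> continuous g.
Proof. by move=> cg t; exact: (@continuous_comp_initial _ _ _ _ g cg t). Qed.

Lemma continuous_set_val (U : topologicalType) (B : set U) :
  continuous (set_val : B -> U).
Proof. by move=> x; exact: (@initial_continuous _ _ set_val x). Qed.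

(* Unqualified [tychonoff] is the library's theorem on products of compact sets. *)
Lemma tychonoff_initial (R : realType) (S : choiceType) (T : topologicalType)
    (w : S -> T) :
  injective w -> Defs.tychonoff T -> Defs.tychonoff (initial_topology w).
Proof.
move=> injw /(tychonoffP R)[sepT cT]; apply/(tychonoffP R); split.
- move=> a B cB nBa.
  (* Open sets of the initial topology are preimages under [w], so a function separating [w a] from
     the complement of [V] pulls back to one separating [a] from [B]. *)
  have [V oV VE] : open (~` B : set (initial_topology w)).
    exact/closed_openC.
  have cV : closed (~` V) by exact/open_closedC.
  have wa : ~ (~` V) (w a).
    by apply; have : (~` B) a by []; rewrite -VE.
  have [h [ch h01 h0 h1]] := sepT _ _ cV wa.
  exists (h \o w); split=> //.
  + move=> x; apply: (@continuous_comp (initial_topology w) _ _ w h).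
      exact: initial_continuous.
    exact: ch.
  + by move=> _ [x _ <-]; apply: h01; exists (w x).
  + move=> b Bb; apply: h1 => /= Vb.
    by have : (w @^-1` V) b by []; rewrite VE; exact.
(* Injectivity of [w] makes each point the preimage of a closed point. *)
- move=> a; have -> : [set a] = w @^-1` [set w a].
    by apply/seteqP; split=> [x -> //|x /= /injw].
  apply: closed_comp => //; move=> x _; exact: initial_continuous.
Qed.

(** The inclusion maps [K] continuously onto its image, and continuous surjections preserve
    pseudocompactness. Thus the hypothesis on subsets of [X] reaches subsets of [A]. *)
Lemma pseudocompact_set_val (R : realType) (X : topologicalType) (A : set X)
    (K : set A) :
  pseudocompact_set R K -> pseudocompact_set R [set set_val x | x in K].
Proof.
apply: (@pseudocompact_surj _ _ _ (sigLR [fun set_val in K])).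
- apply: continuous_set_valP => x.
  by apply: (@continuous_comp K A X set_val set_val); exact: continuous_set_val.
- move=> [y yK]; have [x Kx xy] := set_mem yK.
  by exists (SigSub (mem_set Kx)); apply: val_inj.
Qed.

Theorem theorem3p13 (R : realType) (X : topologicalType) :
  ps_tychonoff R X -> forall A : set X, ps_tychonoff R (set_type A).
Proof.
move=> [Y [f [tY bf homf]]] A.
pose w : set_type A -> Y := f \o set_val.
have injw : injective w by move=> x y /(bij_inj bf); exact: val_inj.
exists (initial_topology w), (id : set_type A -> initial_topology w); split.
- exact: (tychonoff_initial R).
- by exists id.
move=> K /(pseudocompact_set_val (K := K)) /homf.
set K' := [set set_val x | x in K] => -[g [fgK gfK cf cg]].
set e := sigLR _.
have K'P (x : K) : K' (set_val (set_val x)).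
  by exists (set_val x) => //; exact: set_valP.
pose p (x : K) : K' := SigSub (mem_set (K'P x)).
have ep : forall z : [set x | x in K], K (set_val z).
  by move=> z; have [x Kx xz] := set_valP z; rewrite (_ : set_val z = x).
(* The inverse of [e] fixes the underlying points; only its continuity has content. *)
pose g' (z : [set (x : initial_topology w) | x in K]) : K :=
  SigSub (mem_set (ep z)).
have qP (z : [set (x : initial_topology w) | x in K]) :
  (f @` K') (w (set_val z)).
  by exists (set_val (set_val z)) => //; exists (set_val z).
(* With [p] and [e], this closes a commuting square over the restriction of [f] to [K']. *)
pose q (z : [set (x : initial_topology w) | x in K]) : f @` K' :=
  SigSub (mem_set (qP z)).
have cp : continuous p.
  apply: continuous_set_valP => x.
  by apply: (@continuous_comp K A X set_val set_val); exact: continuous_set_val.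
have cq : continuous q.
  apply: continuous_set_valP => z.
  apply: (@continuous_comp _ (initial_topology w) _ set_val w).
    exact: continuous_set_val.
  exact: initial_continuous.
exists g'; split.
- by move=> x; exact: val_inj.
- by move=> z; exact: val_inj.
- apply: continuous_set_valP => x.
  (* Continuity into the initial topology is tested after [w], where [e] becomes the restriction of
     [f] composed with [p]. *)
  apply: (@continuous_comp_initial _ _ _ w (set_val \o e)) => {}x.
  have -> : w \o (set_val \o e) = set_val \o sigLR [fun f in K'] \o p by [].
  apply: continuous_comp; first exact: cp.
  by apply: continuous_comp; [exact: cf|exact: continuous_set_val].
(* [K] is a subtype of the subtype [A]: two inclusions lead to [X], where [g'] agrees with
   [g \o q]. *)
- apply: continuous_set_valP; apply: continuous_set_valP => z.
  have -> : set_val \o (set_val \o g') = set_val \o g \o q.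
    apply/funext => u /=.
    have -> : q u = sigLR [fun f in K'] (p (g' u)) by exact: val_inj.
    by rewrite fgK.
  apply: continuous_comp; first exact: cq.
  by apply: continuous_comp; [exact: cg|exact: continuous_set_val].
Qed.
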